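(* Let $S\subseteq G\setminus\{0\}$ be non-empty, $p\in(0,\infty)$, $\mu_0\in\mathcal M$, and let $(\mu_n)_{n\in\mathbb N}$ be a sequence in $\mathcal M$ with $\mathrm{w}^*\text{-}\lim\mu_n=\mu_0$. (i) If $d_p(\mu_0;S)=0$, then $\lim_{n\to\infty}d_p(\mu_n;S)=d_p(\mu_0;S)$. (ii) If there exists a sequence $(c_n)_{n\in\mathbb N}$ of positive real numbers such that $\liminf_{n\to\infty}c_n\ge1$ and $c_n\mu_0\le\mu_n$ for all $n\in\mathbb N$, then $\lim_{n\to\infty}d_p(\mu_n;S)=d_p(\mu_0;S)$.
   Context: $G$ is a locally compact abelian Hausdorff group (written additively), $\Gamma$ is its dual group, and for $x\in G$, $e_x:\Gamma\to\mathbb C$ denotes the character of $\Gamma$ generated by $x$. $\mathcal M$ is the set of all non-zero finite non-negative regular Borel measures on $\Gamma$. For a non-empty set $S\subseteq G\setminus\{0\}$, $\mathcal T(S)$ is the complex linear space of all finite sums $\sum_j a_je_{x_j}$ with $a_j\in\mathbb C$, $x_j\in S$. For $\mu\in\mathcal M$ and $p\in(0,\infty)$, $d_p(\mu;S):=\inf\{\int|1-\tau|^p\,d\mu:\tau\in\mathcal T(S)\}$. $\mathrm{w}^*\text{-}\lim\mu_n=\mu_0$ means that $\lim_{n}\int f\,d\mu_n=\int f\,d\mu_0$ for every bounded continuous function $f:\Gamma\to\mathbb C$. Inequalities between measures are setwise on Borel sets. *)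

(* Defs.v *)
From HB Require Import structures.
From mathcomp Require Import all_boot all_order all_algebra complex.
From mathcomp Require Import all_classical all_reals all_analysis.

Set Implicit Arguments.
Unset Strict Implicit.
Unset Printing Implicit Defensive.

Import Order.TTheory GRing.Theory Num.Theory.
Import numFieldNormedType.Exports.
Import Normc.

Local Open Scope classical_set_scope.
Local Open Scope ring_scope.
Local Open Scope complex_scope.

(* R[i] carries the topology of its modulus. *)
HB.instance Definition _ (R : realType) := NormedModule.copy R[i] R[i]^o.

Section DualGroup.
Variables (R : realType) (G : topologicalZmodType).

Definition is_character (chi : G -> R[i]) : Prop :=
  [/\ continuous chi,
      forall x y : G, chi (x + y) = chi x * chi y &
      forall x : G, normc (chi x) = 1].

(* Restricting the codomain from R[i] to the unit circle would not change the
   compact-open topology. *)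
Definition dual_group : Type :=
  set_type ([set chi | is_character chi] : set {compact-open, G -> R[i]}).

HB.instance Definition _ := Choice.on dual_group.
HB.instance Definition _ := Topological.on dual_group.

(* e_x, the character of the dual group generated by x *)
Definition char_of (x : G) (gamma : dual_group) : R[i] := \val gamma x.

Lemma dual_groupP (gamma : dual_group) : is_character (char_of^~ gamma).
Proof. by have /set_mem := valP gamma. Qed.

Definition mk_dual (chi : G -> R[i]) (h : is_character chi) : dual_group :=
  exist _ chi (mem_set h).

Lemma is_character1 : is_character (fun=> 1).
Proof. by split=> [x|x y|x]; [exact: cvg_cst|rewrite mulr1|exact: normc1]. Qed.

Lemma is_characterM (g h : dual_group) :
  is_character (fun x => char_of x g * char_of x h).
Proof.
have [gc gD g1] := dual_groupP g; have [hc hD h1] := dual_groupP h.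
split=> [x|x y|x]; last by rewrite normcM g1 h1 mulr1.
- exact: (@cvgM R[i] _ _ _ _ _ _ _ (gc x) (hc x)).
- by rewrite gD hD mulrACA.
Qed.

Lemma is_characterV (g : dual_group) : is_character (fun x => (char_of x g)^-1).
Proof.
have [gc gD g1] := dual_groupP g.
have g0 x : char_of x g != 0.
  by apply: contra_eq_neq (g1 x) => ->; rewrite normc0 eq_sym oner_neq0.
split=> [x|x y|x]; last by rewrite normcV g1 invr1.
- exact: (@cvgV R[i] _ _ _ _ _ (g0 x) (gc x)).
- by rewrite gD invfM.
Qed.

Definition dual_zero := mk_dual is_character1.
Definition dual_add g h := mk_dual (is_characterM g h).
Definition dual_opp g := mk_dual (is_characterV g).

Lemma dual_addA : associative dual_add.
Proof. by move=> f g h; apply/val_inj/funext => x /=; rewrite /char_of/= mulrA. Qed.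

Lemma dual_addC : commutative dual_add.
Proof. by move=> g h; apply/val_inj/funext => x /=; rewrite /char_of/= mulrC. Qed.

Lemma dual_add0 : left_id dual_zero dual_add.
Proof. by move=> g; apply/val_inj/funext => x /=; rewrite /char_of/= mul1r. Qed.

Lemma dual_addN : left_inverse dual_zero dual_opp dual_add.
Proof.
move=> g; apply/val_inj/funext => x /=; rewrite /char_of/= mulVf//.
have [_ _ /(_ x)] := dual_groupP g; rewrite /char_of => g1.
by apply: contra_eq_neq g1 => ->; rewrite normc0 eq_sym oner_neq0.
Qed.

HB.instance Definition _ := GRing.isZmodule.Build dual_group
  dual_addA dual_addC dual_add0 dual_addN.
HB.instance Definition _ := isPointed.Build dual_group dual_zero.

(* Borel sigma-algebra *)
HB.instance Definition _ :=
  Measurable.copy dual_group (g_sigma_algebraType (@open dual_group)).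

End DualGroup.

Section Approximation.
Variables (R : realType) (G : topologicalZmodType).
Local Notation Gamma := (dual_group R G).

Implicit Types (mu : {finite_measure set Gamma -> \bar R}) (S : set G).

Definition regular mu : Prop := forall A : set Gamma, measurable A ->
  mu A = ereal_sup [set mu K | K in [set K | compact K /\ K `<=` A]] /\
  mu A = ereal_inf [set mu U | U in [set U | open U /\ A `<=` U]].

(* Library measures are unconstrained on non-measurable sets, so being non-zero
   is expressed on Borel sets only. *)
Definition nonzero mu : Prop := exists2 A, measurable A & mu A != 0%E.

Definition measM : set {finite_measure set Gamma -> \bar R} :=
  [set mu | nonzero mu /\ regular mu].

(* The case n = 0 gives the zero function. *)
Definition trig_poly S : set (Gamma -> R[i]) :=
  [set tau | exists n (a : 'I_n -> R[i]) (x : 'I_n -> G),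
    (forall j, S (x j)) /\
    tau = (fun gamma => \sum_(j < n) a j * char_of (x j) gamma)].

Definition d_p (p : R) mu S : \bar R :=
  ereal_inf [set (\int[mu]_gamma (normc (1 - tau gamma) `^ p)%:E)%E
            | tau in trig_poly S].

Definition Cintegral mu (f : Gamma -> R[i]) : R[i] :=
  (\int[mu]_gamma complex.Re (f gamma)) +i*
  (\int[mu]_gamma complex.Im (f gamma)).

Definition weak_star_lim (mu_ : {finite_measure set Gamma -> \bar R}^nat) mu0 :
    Prop :=
  forall f : Gamma -> R[i], continuous f ->
    (exists M : R, forall gamma, normc (f gamma) <= M) ->
    Cintegral (mu_ n) f @[n --> \oo] --> Cintegral mu0 f.

End Approximation.

(* Main.v *)
Require Import Defs.
From HB Require Import structures.
From mathcomp Require Import all_boot all_order all_algebra complex.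
From mathcomp Require Import all_classical all_reals all_analysis.
From mathcomp Require Import lra.
From mathcomp Require Import measurable_realfun.

Set Implicit Arguments.
Unset Strict Implicit.
Unset Printing Implicit Defensive.

Import Order.TTheory GRing.Theory Num.Theory.
Import numFieldNormedType.Exports.

(** For a trigonometric polynomial tau, the function |1 - tau| ^ p is bounded
    and continuous on the dual group, so its integral is a legitimate test of
    weak-star convergence: its integrals against mu_n converge to its integral
    against mu0 ([cvg_integral_weak_star]).  Hence d_p is an infimum of
    weak-star continuous functionals of the measure, and such an infimum is
    upper semicontinuous: the limit superior of d_p (mu_n) is at most
    d_p (mu0) ([d_p_upper_semicontinuous]).

    What remains is that the limit inferior of d_p (mu_n) is at least
    d_p (mu0).  When d_p (mu0) = 0 this is the non-negativity of d_p.  When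
    c_n mu0 <= mu_n, integrating |1 - tau| ^ p and taking infima gives
    c_n d_p (mu0) <= d_p (mu_n) ([le_d_p_scale]), and c_n eventually exceeds
    every number below 1.

    Continuity of the characters e_x, on which everything rests, is the
    continuity of the evaluation at a point for the compact-open topology,
    singletons being compact ([continuous_char_of]). *)

Local Open Scope classical_set_scope.
Local Open Scope ring_scope.

(** * Continuity of the modulus and of powers of the absolute value *)

Section ComplexContinuity.
Variable R : realType.

Lemma continuous_Re : continuous (@complex.Re R : R[i] -> R).
Proof.
move=> z; apply/(cvgrPdist_lt (FF := nbhs_filter z)) => e e0.
have ec0 : 0 < e%:C%C by rewrite ltcR.
have : \forall w \near z, `|z - w| < e%:C%C by apply/nbhs_ballP; exists e%:C%C.
apply: filterS => w zw; rewrite -ltcR; apply: le_lt_trans zw.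
by have := normc_ge_Re (z - w); rewrite raddfB.
Qed.

Lemma continuous_real_complex : continuous (fun x : R => x%:C%C).
Proof.
move=> x; apply/(cvgrPdist_lt (FF := nbhs_filter x)) => e e0.
have [eI eR] : complex.Im e = 0 /\ 0 < complex.Re e.
  by move: e0; rewrite ltcE/= => /andP[/eqP].
have : \forall y \near x, `|x - y| < complex.Re e.
  by apply/nbhs_ballP; exists (complex.Re e).
apply: filterS => y xy.
rewrite -rmorphB/= normc_def/= expr0n addr0 sqrtr_sqr.
by rewrite ltcE/= eI eqxx.
Qed.

Lemma normcE (z : R[i]) : Normc.normc z = complex.Re `|z|.
Proof. by case: z. Qed.

Lemma normc_ge0 (z : R[i]) : 0 <= Normc.normc z.
Proof. by case: z => a b; exact: sqrtr_ge0. Qed.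

Lemma continuous_normc : continuous (@Normc.normc R : R[i] -> R).
Proof.
rewrite (_ : @Normc.normc R = @complex.Re R \o (fun z : R[i] => `|z|)); last first.
  by apply/funext => z; exact: normcE.
move=> z; apply: continuous_comp; last exact: continuous_Re.
exact: (@norm_continuous R[i] R[i]).
Qed.

(** Away from 0 the power is differentiable.  At 0 continuity comes from
    monotonicity and p > 0.  Without the absolute value continuity would fail
    at 0, as the power of a negative number is 1 by convention. *)
Lemma continuous_powR_norm (p : R) : 0 < p ->
  continuous (fun x : R => `|x| `^ p).
Proof.
move=> p0 x; have [->|x0] := eqVneq x 0.
  apply/cvgrPdist_lt => e e0; rewrite normr0 powR0 ?gt_eqF//.
  (* |y| ^ p < e as soon as |y| < e ^ (1 / p) *)
  near=> y; rewrite sub0r normrN ger0_norm ?powR_ge0//.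
  rewrite -[ltRHS]powRr1 ?ltW// -(mulVf (lt0r_neq0 p0)) powRrM.
  apply: gt0_ltr_powR => //; rewrite ?nnegrE ?powR_ge0//.
  rewrite -[y]subr0 distrC; near: y.
  by apply/nbhs_ballP; exists (e `^ p^-1); rewrite //= powR_gt0.
apply: (@continuous_comp _ _ _ (fun x : R => `|x|) (fun a => a `^ p)).
  exact: norm_continuous.
apply/differentiable_continuous/derivable1_diffP/derivable_powR.
by rewrite in_itv/= normr_gt0 x0.
Unshelve. all: by end_near. Qed.

End ComplexContinuity.

(** * Trigonometric polynomials on the dual group *)

Section Dual.
Variables (R : realType) (G : topologicalZmodType).
Local Notation Gamma := (dual_group R G).

(** The sets of functions mapping the compact set {x} into a given open set
    are open for the compact-open topology, and their traces on the dual group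
    are the preimages of open sets under e_x. *)
Lemma continuous_char_of (x : G) : continuous (@char_of R G x).
Proof.
move=> g.
pose ev := fun h : {compact-open, G -> R[i]} => h x.
apply: (@continuous_comp _ _ _ (\val : Gamma -> {compact-open, G -> R[i]}) ev).
  exact: (@initial_continuous _ _ (\val : Gamma -> {compact-open, G -> R[i]})).
pose h : {compact-open, G -> R[i]} := \val g; rewrite -/h.
move=> B /=; rewrite nbhsE => -[U [oU Ugx] UB].
have : open [set k : {compact-open, G -> R[i]} | k @` [set x] `<=` U].
  by apply: compact_open_open => //; exact: compact_set1.
rewrite openE => /(_ h) /=; rewrite image_set1 sub1set inE => /(_ Ugx).
by apply: filterS => k /=; rewrite image_set1 sub1set inE; exact: UB.
Qed.

Lemma continuous_trig_poly (S : set G) tau :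
  trig_poly S tau -> continuous (tau : Gamma -> R[i]).
Proof.
case=> n [a [x [_ ->]]].
apply: continuous_big => [|j _ g]; first exact: add_continuous.
have FF : Filter (nbhs g) := nbhs_filter g.
apply: (@cvgM R[i]); first exact: cvg_cst.
exact: continuous_char_of.
Qed.

(** Each character has modulus 1, so the sum of the moduli of the coefficients
    is a bound. *)
Lemma bounded_trig_poly (S : set G) tau : trig_poly S tau ->
  exists M : R, forall gamma : Gamma, Normc.normc (tau gamma) <= M.
Proof.
case=> n [a [x [_ ->]]]; exists (\sum_(j < n) Normc.normc (a j)) => g.
elim/big_rec2: _ => [|j y z _ IH]; first by rewrite Normc.normc0.
apply: le_trans (le_normcD _ _) _; rewrite lerD// Normc.normcM.
by have [_ _ /(_ (x j)) ->] := dual_groupP g; rewrite mulr1.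
Qed.

(** * Integrals against weak-star convergent measures *)

Lemma continuous_measurable_dual (f : Gamma -> R) :
  continuous f -> measurable_fun setT f.
Proof.
move=> /continuousP cf; apply: (measurability _ (RGenOpens.measurableE R)).
move=> _ [_ [a [b ->] <-]]; rewrite setTI.
by apply: sub_sigma_algebra; apply/cf/interval_open.
Qed.

Lemma integrable_bounded_continuous (mu : {finite_measure set Gamma -> \bar R})
    (f : Gamma -> R) (M : R) :
  continuous f -> (forall g, 0 <= f g <= M) ->
  mu.-integrable setT (EFin \o f).
Proof.
move=> fc fM; apply: measurable_bounded_integrable => //.
- by rewrite -ge0_fin_numE ?fin_num_measure.
- exact: continuous_measurable_dual.
- exists M; split=> [|N MN g _]; first exact: num_real.
  rewrite /=; have /andP[f0 fgM] := fM g.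
  by rewrite ger0_norm// (le_trans fgM)// ltW.
Qed.

(** Weak-star convergence is stated for complex test functions; a real one is
    embedded in the complex numbers and the real part of the limit is taken. *)
Lemma cvg_integral_weak_star (mu_ : {finite_measure set Gamma -> \bar R}^nat)
    (mu0 : {finite_measure set Gamma -> \bar R}) (f : Gamma -> R) (M : R) :
  weak_star_lim mu_ mu0 -> continuous f -> (forall g, 0 <= f g <= M) ->
  (\int[mu_ n]_g (f g)%:E)%E @[n --> \oo] --> (\int[mu0]_g (f g)%:E)%E.
Proof.
move=> mu_cvg fc fM.
have fin (mu : {finite_measure set Gamma -> \bar R}) :
    (\int[mu]_g (f g)%:E)%E \is a fin_num.
  exact/integrable_fin_num/(integrable_bounded_continuous mu fc fM).
have fCc : continuous (fun g => (f g)%:C%C : R[i]).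
  by move=> g; apply: continuous_comp; [exact: fc|exact: continuous_real_complex].
have fCb : exists M' : R, forall g, Normc.normc ((f g)%:C%C : R[i]) <= M'.
  exists M => g; have /andP[f0 fgM] := fM g.
  by rewrite /= expr0n addr0 sqrtr_sqr ger0_norm.
have Re_cvg := cvg_comp _ _ (mu_cvg _ fCc fCb) (@continuous_Re R _).
rewrite -(fineK (fin mu0)); apply/fine_cvgP; split; first by near=> n; exact: fin.
exact: Re_cvg.
Unshelve. all: by end_near. Qed.

(** * The integrands |1 - tau| ^ p *)

Variable p : R.
Hypothesis p_gt0 : 0 < p.

Definition residual (tau : Gamma -> R[i]) (gamma : Gamma) : R :=
  Normc.normc (1 - tau gamma) `^ p.

Lemma residual_ge0 tau gamma : 0 <= residual tau gamma.
Proof. exact: powR_ge0. Qed.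

Lemma continuous_residual (S : set G) tau :
  trig_poly S tau -> continuous (residual tau).
Proof.
move=> /continuous_trig_poly tauc.
rewrite (_ : residual tau = (fun x => `|x| `^ p) \o
    (@Normc.normc R \o (fun g => 1 - tau g))); last first.
  by apply/funext => g; rewrite /= ger0_norm// normc_ge0.
move=> g; apply: continuous_comp; last exact: (@continuous_powR_norm R p p_gt0).
apply: continuous_comp; last exact: (@continuous_normc R).
have FF : Filter (nbhs g) := nbhs_filter g.
apply: (@cvgB R[i] R[i]); first exact: cvg_cst.
exact: tauc.
Qed.

Lemma bounded_residual (S : set G) tau : trig_poly S tau ->
  exists M : R, forall gamma : Gamma, residual tau gamma <= M.
Proof.
move=> /bounded_trig_poly[M tauM]; exists ((1 + M) `^ p) => g.
have M0 : 0 <= M := le_trans (normc_ge0 _) (tauM g).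
apply: ge0_ler_powR; rewrite ?nnegrE ?addr_ge0 ?normc_ge0 ?(ltW p_gt0)//.
apply: le_trans (le_normcD _ _) _.
by rewrite normcN Normc.normc1 lerD.
Qed.

(** * Behaviour of d_p under limits and comparison of measures *)

Lemma d_p_ge0 (mu : {finite_measure set Gamma -> \bar R}) (S : set G) :
  (0 <= d_p p mu S)%E.
Proof.
apply: le_ereal_inf_tmp => _ [tau _ <-]; apply: integral_ge0 => g _.
by rewrite lee_fin powR_ge0.
Qed.

(** The zero polynomial bounds d_p by the integral of a bounded function against
    a finite measure. *)
Lemma d_p_fin_num (mu : {finite_measure set Gamma -> \bar R}) (S : set G) :
  d_p p mu S \is a fin_num.
Proof.
have S0 : trig_poly S (fun=> 0 : R[i]).
  exists 0%N, (fun=> 0), (fun=> 0); split; first by case.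
  by apply/funext => g; rewrite big_ord0.
have [M rM] := bounded_residual S0.
rewrite ge0_fin_numE ?d_p_ge0//.
apply: (@le_lt_trans _ _ (\int[mu]_g (residual (fun=> 0) g)%:E)%E).
  by apply: ereal_inf_lbound; exists (fun=> 0).
rewrite -ge0_fin_numE; last first.
  by apply: integral_ge0 => g _; rewrite lee_fin residual_ge0.
apply: integrable_fin_num => //.
apply: (integrable_bounded_continuous (M := M) mu (continuous_residual S0)) => g.
by rewrite residual_ge0 rM.
Qed.

(** A tau with integral below x at mu0 keeps its integral below x at mu_n for
    large n, and then it bounds d_p (mu_n). *)
Lemma d_p_upper_semicontinuous (S : set G)
    (mu_ : {finite_measure set Gamma -> \bar R}^nat)
    (mu0 : {finite_measure set Gamma -> \bar R}) (x : \bar R) :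
  weak_star_lim mu_ mu0 -> (d_p p mu0 S < x)%E ->
  \forall n \near \oo, (d_p p (mu_ n) S < x)%E.
Proof.
move=> mu_cvg /ereal_inf_lt[_ [tau Stau <-]] taux.
have [M rM] := bounded_residual Stau.
have rb g : 0 <= residual tau g <= M by rewrite residual_ge0 rM.
have int_cvg := cvg_integral_weak_star mu_cvg (continuous_residual Stau) rb.
have : \forall n \near \oo, (\int[mu_ n]_g (residual tau g)%:E < x)%E.
  exact: (int_cvg _ (open_ereal_lt' taux)).
apply: filterS => n; apply: le_lt_trans.
by apply: ereal_inf_lbound; exists tau.
Qed.

(** The infimum defining d_p (nu) is compared term by term: each integral
    against nu is at least c times the integral against mu. *)
Lemma le_d_p_scale (c : R) (mu nu : {finite_measure set Gamma -> \bar R})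
    (S : set G) : 0 < c ->
  (forall A, measurable A -> (c%:E * mu A <= nu A)%E) ->
  (c%:E * d_p p mu S <= d_p p nu S)%E.
Proof.
move=> c0 munu; apply: le_ereal_inf_tmp => _ [tau Stau <-].
have /measurable_EFinP mr :=
  continuous_measurable_dual (continuous_residual Stau).
have r0 g : (0 <= (residual tau g)%:E)%E by rewrite lee_fin residual_ge0.
apply: (@le_trans _ _ (c%:E * \int[mu]_g (residual tau g)%:E)%E).
  by rewrite lee_pmul2l//; apply: ereal_inf_lbound; exists tau.
pose C := NngNum (ltW c0).
rewrite -(ge0_integral_mscale mu measurableT C)//.
exact: (@ge0_le_measure_integral _ _ _ (mscale C mu) nu).
Qed.

End Dual.

(** * Limits of extended real sequences *)

Section Limits.
Variable R : realType.

Lemma cvge_near_bounds (u : (\bar R)^nat) (l : \bar R) : l \is a fin_num ->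
  (forall x, (x < l)%E -> \forall n \near \oo, (x < u n)%E) ->
  (forall x, (l < x)%E -> \forall n \near \oo, (u n < x)%E) ->
  u n @[n --> \oo] --> l.
Proof.
move=> /fineK <-; move: (fine l) => r lo hi.
have bnd (e : R) : 0 < e ->
    \forall n \near \oo, ((r - e)%:E < u n)%E /\ (u n < (r + e)%:E)%E.
  move=> e0; near=> n; split; near: n.
    by apply: lo; rewrite lte_fin ltrBlDr ltrDl.
  by apply: hi; rewrite lte_fin ltrDl.
apply/fine_cvgP; split.
  by apply: filterS (bnd 1 ltr01) => n []; case: (u n).
apply/cvgrPdist_lt => e /bnd; apply: filterS => n [] /=.
by case: (u n) => //= x; rewrite !lte_fin ltr_distl => *; lra.
Unshelve. all: by end_near. Qed.

Lemma near_lt_limn_einf (u : (\bar R)^nat) (x : \bar R) :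
  (x < limn_einf u)%E -> \forall n \near \oo, (x < u n)%E.
Proof.
rewrite limn_einf_lim (cvg_lim _ (@cvg_einfs_sup _ _))//.
move=> /ereal_sup_gt[_ [m _ <-] xm]; exists m => // n /= mn.
by apply: lt_le_trans xm _; apply: ereal_inf_lbound; exists n.
Qed.

End Limits.

Theorem corollary3p3 (R : realType) (G : topologicalZmodType)
    (G_hausdorff : hausdorff_space G) (G_lc : locally_compact [set: G])
    (S : set G) (S_neq0 : S !=set0) (S_sub : S `<=` [set~ 0])
    (p : R) (p_gt0 : 0 < p)
    (mu0 : {finite_measure set (dual_group R G) -> \bar R})
    (mu0_M : measM mu0)
    (mu_ : nat -> {finite_measure set (dual_group R G) -> \bar R})
    (mu_M : forall n, measM (mu_ n))
    (mu_cvg : weak_star_lim mu_ mu0) :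
  (d_p p mu0 S = 0%E -> d_p p (mu_ n) S @[n --> \oo] --> d_p p mu0 S) /\
  ((exists c : nat -> R,
      [/\ forall n, 0 < c n,
          (1 <= limn_einf (fun n => (c n)%:E))%E &
          forall (n : nat) (A : set (dual_group R G)), measurable A ->
            ((c n)%:E * mu0 A <= mu_ n A)%E]) ->
    d_p p (mu_ n) S @[n --> \oo] --> d_p p mu0 S).
Proof.
have usc x := @d_p_upper_semicontinuous R G p p_gt0 S mu_ mu0 x mu_cvg.
have d0_fin := d_p_fin_num p_gt0 mu0 S.
have below0 x : (x < 0)%E -> \forall n \near \oo, (x < d_p p (mu_ n) S)%E.
  by move=> x0; near=> n; exact: lt_le_trans x0 (d_p_ge0 _ _ _).
split=> [d00 | [c [c_gt0 c_liminf c_le]]];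
  apply: cvge_near_bounds => // x; first by rewrite d00; exact: below0.
(* For 0 <= x < d_p mu0 S, the ratio x / d_p mu0 S is below 1, hence
   eventually below c n, which gives x < c n * d_p mu0 S <= d_p (mu_ n) S. *)
have [/below0 //|x_ge0 x_lt] := ltP x 0%E.
have x_fin : x \is a fin_num.
  by rewrite ge0_fin_numE// (lt_le_trans x_lt) ?leey.
have d_gt0 : 0 < fine (d_p p mu0 S).
  by rewrite -lte_fin fineK// (le_lt_trans x_ge0).
have /near_lt_limn_einf : ((fine x / fine (d_p p mu0 S))%:E
    < limn_einf (fun n => (c n)%:E))%E.
  apply: lt_le_trans c_liminf.
  by rewrite lte_fin ltr_pdivrMr// mul1r -lte_fin !fineK.
apply: filterS => n; rewrite lte_fin ltr_pdivrMr// -lte_fin EFinM !fineK//.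
by move=> /lt_le_trans; apply; exact: le_d_p_scale (c_gt0 n) (c_le n).
Unshelve. all: by end_near. Qed.
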